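(* Let $G=(V,E)$ be a finite graph with $m=|E|$ edges, let $p\in(0,1)$ and let $q\ge 1$ be an integer. Let $P_{\rm SW}$ and $P_{\rm HB}$ be the transition matrices of the Swendsen-Wang dynamics and of the heat-bath dynamics, respectively, for the random-cluster model on $G$ with parameters $p$ and $q$. Then $$\lambda(P_{\rm SW})\;\le\;16\,m\log(m)\;\lambda(P_{\rm HB}).$$
   Context: $\log$ is the natural logarithm. The random-cluster (RC) model on $G=(V,E)$ with parameters $p,q$ has state space $\Omega_{\rm RC}=\{A: A\subseteq E\}$ and probability measure $\mu(A)=\frac{1}{Z}\left(\frac{p}{1-p}\right)^{|A|}q^{c(A)}$, where $c(A)$ is the number of connected components of $(V,A)$ (isolated vertices count as components) and $Z$ is the normalizing constant. Swendsen-Wang dynamics: from $A\subseteq E$, colour each connected component of $(V,A)$ independently and uniformly at random with a colour from $[q]=\{1,\dots,q\}$, obtaining $\sigma\in[q]^V$; then take $E(\sigma)=\{\{u,v\}\in E:\sigma(u)=\sigma(v)\}$ and delete each of its edges independently with probability $1-p$; the result is the new state. Equivalently, $$P_{\rm SW}(A,B)=q^{-c(A)}\left(\tfrac{p}{1-p}\right)^{|B|}\sum_{\sigma\in[q]^V}(1-p)^{|E(\sigma)|}\,\mathbf 1(A\cup B\subseteq E(\sigma)).$$ (Lazy) heat-bath dynamics: for $A\ne B$, $$P_{\rm HB}(A,B)=\frac{1}{2|E|}\sum_{e\in E}\frac{\mu(B)}{\mu(A\cup\{e\})+\mu(A\setminus\{e\})}\,\mathbf 1(A\ominus B\subseteq\{e\}),$$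 where $\ominus$ is symmetric difference, and $P_{\rm HB}(A,A)$ is chosen so that $P_{\rm HB}$ is stochastic. The spectral gap of a transition matrix $P$ is $\lambda(P)=1-\max\{|\xi|:\xi\text{ is an eigenvalue of }P,\ \xi\ne1\}$.
   Formalization: The formal theorem assumes m ≥ 2: for m = 1 the right-hand side is 0 while λ(P_SW) = 1 − p(1 − 1/q) > 0, so the claim is false, and for m = 0 both log(m) and the maximum over eigenvalues ≠ 1 are undefined. *)

(* Defs.v *)
From HB Require Import structures.
From mathcomp Require Import all_boot all_order all_algebra.
From mathcomp Require Import all_classical all_reals all_analysis.
From mathcomp Require Import complex.

Set Implicit Arguments.
Unset Strict Implicit.
Unset Printing Implicit Defensive.

Import Order.TTheory GRing.Theory Num.Theory.
Local Open Scope ring_scope.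
Local Open Scope complex_scope.

(* A finite simple graph is given by its vertex type V and its edge set
   E : {set {set V}}, whose members are 2-element sets; this last condition is
   a hypothesis of the theorem, not part of the definitions below.
   Configurations are subsets of E, i.e. elements of powerset E. *)

Section SpectralGap.
Variables (R : realType) (T : finType) (S : {set T}) (P : T -> T -> R).

Definition kernel_mx : 'M[R[i]]_#|S| :=
  \matrix_(i, j) (P (enum_val i) (enum_val j))%:C.

(* A finite set of reals, so that sup is max as soon as it is nonempty. *)
Definition nontrivial_eigenvalue_moduli : set R :=
  [set x : R | exists xi : R[i],
     [/\ eigenvalue kernel_mx xi, xi != 1 & x%:C = `|xi|]]%classic.

Definition spectral_gap : R := 1 - sup nontrivial_eigenvalue_moduli.

End SpectralGap.

Section RandomCluster.
Variables (R : realType) (V : finType) (E : {set {set V}}) (p : R) (q : nat).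
Implicit Types A B : {set {set V}}.

Definition edge_rel A : rel V := fun u v => [set u; v] \in A.

Definition components A : nat := n_comp (edge_rel A) predT.

Definition rc_weight A : R := (p / (1 - p)) ^+ #|A| * q%:R ^+ components A.

Definition rc_measure A : R :=
  rc_weight A / \sum_(B in powerset E) rc_weight B.

Definition mono_edges (sigma : {ffun V -> 'I_q}) : {set {set V}} :=
  [set e in E | [forall u in e, forall v in e, sigma u == sigma v]].

(* Closed form of the two-step dynamics; see P_SW_two_step. *)
Definition P_SW A B : R :=
  q%:R ^- components A * (p / (1 - p)) ^+ #|B| *
  \sum_(sigma : {ffun V -> 'I_q})
     (1 - p) ^+ #|mono_edges sigma| * (A :|: B \subset mono_edges sigma)%:R.

(* The first factor of each summand is the probability that colouring the
   components of (V, A) uniformly yields sigma (sigma is constant on these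
   components iff A is contained in mono_edges sigma); the second one is the
   probability that percolation on mono_edges sigma yields B. *)
Lemma P_SW_two_step A B : p < 1 ->
  P_SW A B =
  \sum_(sigma : {ffun V -> 'I_q})
     ((A \subset mono_edges sigma)%:R * q%:R ^- components A) *
     ((B \subset mono_edges sigma)%:R *
        (p ^+ #|B| * (1 - p) ^+ #|mono_edges sigma :\: B|)).
Proof.
move=> p_lt1; rewrite /P_SW mulr_sumr; apply: eq_bigr => sigma _.
rewrite finset.subUset; case: (A \subset _); case: (boolP (B \subset _)) => sB;
  rewrite ?(mulr0, mul0r) //= !mul1r mulr1 -mulrA; congr (_ * _).
have p1_neq0 : 1 - p != 0 by rewrite subr_eq0 gt_eqF.
rewrite cardsD (finset.setIidPr sB) expr_div_n -mulrA; congr (_ * _).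
by rewrite -{1}(subnK (subset_leq_card sB)) exprD mulrC mulfK // expf_neq0.
Qed.

(* Only used for distinct A and B: the transition probability from A to B. *)
Definition hb_move A B : R :=
  (2 * #|E|%:R)^-1 *
  \sum_(e in E)
     rc_measure B / (rc_measure (e |: A) + rc_measure (A :\ e)) *
     ((A :\: B) :|: (B :\: A) \subset [set e])%:R.

Definition P_HB A B : R :=
  if A == B then 1 - \sum_(C in powerset E | C != A) hb_move A C
  else hb_move A B.

End RandomCluster.

(* Main.v *)
Require Import Defs.
From mathcomp Require Import all_boot all_order all_algebra.
From mathcomp Require Import all_classical all_reals all_analysis.
From mathcomp Require Import complex ring lra.

Import Order.TTheory GRing.Theory Num.Theory.
Local Open Scope ring_scope.

(** Both spectral gaps are controlled by Dirichlet forms.  The Swendsen-Wang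
    and the heat-bath chains are reversible for the same weight w, the
    random-cluster weight, so it suffices to compare
      Dir P f = 1/2 sum_(A, B) w A * P A B * (f A - f B)^2
    for the two kernels and to pass from an inequality of forms to one of
    gaps.

    Write r = p / (1 - p).  The weight of A is r^|A| times the number of
    colourings sigma whose set of monochromatic edges E(sigma) contains A
    (card_compatible_colourings, rc_weight_colourings).  In Swendsen-Wang the
    new state is, given sigma, an independent percolation on E(sigma), and so
    is the old one: hence Dir P_SW f is a positive combination over sigma of
    the variances of f under percolation on E(sigma) (dirichlet_sw).  The
    Efron-Stein inequality (efron_stein) bounds each of these variances by the
    sum over e in E(sigma) of p (1 - p) times the mean squared increment of f
    at the edge e.  Summing over sigma again, Dir P_SW f is at most the sum
    over e and over A not containing e of
      (1 - p) * w (e |: A) * (f (e |: A) - f A)^2     (dirichlet_sw_le).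
    The heat-bath form is a sum of the same squares (dirichlet_hb), with
    coefficient
      w A * w (e |: A) / (w A + w (e |: A)) / (2 m).
    Adding e to A only decreases the number of compatible colourings, that is,
    (1 - p) * w (e |: A) <= p * w A, which is exactly the comparison of the
    coefficients needed for Dir P_SW f <= 2 m Dir P_HB f (dirichlet_sw_le_hb).

    From forms to gaps: all entries of P_SW are positive, so 1 is a simple
    eigenvalue and the spectral theorem gives the Poincare inequality with
    constant the gap of P_SW (spectral_gap_poincare).  Transported to P_HB, it
    bounds every eigenvalue of P_HB other than 1; as P_HB has holding
    probability at least 1/2, its eigenvalues are nonnegative and their moduli
    are bounded as well (spectral_gap_ge).  This gives
      gap P_SW <= 2 m gap P_HB                     (spectral_gap_sw_le),
    and 2 <= 16 log m because log m >= log 2 >= 1/2. *)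

Set Implicit Arguments.
Unset Strict Implicit.
Unset Printing Implicit Defensive.

(** * Spectral theory of real symmetric matrices *)

Section RealSymmetric.
Variables (R : realType) (n : nat) (H : 'M[R]_n).
Hypothesis symH : H^T = H.
Local Notation toC := (real_complex R).
Local Notation "M ^t*" := (map_mx (@Num.conj _) (trmx M)) (at level 30).

Lemma adjoint_real_sym : (map_mx toC H)^t* = map_mx toC H.
Proof.
rewrite map_trmx symH; apply/matrixP => i j; rewrite !mxE.
by apply/CrealP/complex_realP; exists (H i j).
Qed.

(** A left eigenvector v satisfies xi * (v v^t* ) = v H v^t*, and the right-hand
    side is its own conjugate. *)
Lemma real_sym_eigenvalue_real (xi : R[i]) :
  eigenvalue (map_mx toC H) xi -> exists2 x, xi = toC x & eigenvalue H x.
Proof.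
case/eigenvalueP => v vH v_neq0.
have N_neq0 : (v *m v^t*) 0 0 != 0.
  rewrite -dotmxE; move: v_neq0; apply: contraNneq => /eqP.
  by rewrite dnorm_eq0.
have eqN : xi *: (v *m v^t*) = xi^* *: (v *m v^t*).
  rewrite scalemxAl -vH -mulmxA -{1}adjoint_real_sym -map_mxM -trmx_mul vH.
  by rewrite linearZ /= map_mxZ -scalemxAr.
have /CrealP/complex_realP [x xiE] : xi^* = xi.
  by move/matrixP: eqN => /(_ 0 0); rewrite mxE [in RHS]mxE => /(mulIf N_neq0).
exists x => //; rewrite -(eigenvalue_map (real_complex R)) /= -xiE.
by apply/eigenvalueP; exists v.
Qed.

(** In coordinates y with respect to a unitary eigenbasis, the quadratic form
    is the sum of the d_k * |y_k|^2. *)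
Lemma rayleigh_quotient_le (s : R) : (forall x, eigenvalue H x -> x <= s) ->
  forall g : 'rV[R]_n, (g *m H *m g^T) 0 0 <= s * (g *m g^T) 0 0.
Proof.
move=> le_s g.
pose A := map_mx toC H; pose U := spectralmx A; pose d := spectral_diag A.
have hermA : A \is hermsymmx.
  by apply/is_hermitianmxP; rewrite expr0 scale1r -[LHS]adjoint_real_sym.
have unitU : U \is unitarymx by apply: spectral_unitarymx.
have AE : A = U^t* *m diag_mx d *m U.
  have /hermitian_normalmx/orthomx_spectralP := hermA.
  by rewrite invmx_unitary.
have eigen_d k : exists2 x, d 0 k = toC x & x <= s.
  have /real_sym_eigenvalue_real [x dE /le_s] : eigenvalue A (d 0 k).
    apply/eigenvalueP; exists (row k U).
      rewrite AE -row_mul !mulmxA (unitarymxP unitU) mul1mx.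
      by apply/rowP => j; rewrite mul_diag_mx !mxE.
    apply/eqP => /(congr1 (fun u => (u *m (row k U)^t*) 0 0)).
    rewrite mul0mx -dotmxE (row_unitarymxP unitU) eqxx.
    by move/eqP; rewrite mxE oner_eq0.
  by move=> x_le; exists x.
pose gC := map_mx toC g; pose y := gC *m U^t*.
have gCt : gC^t* = map_mx toC g^T.
  apply/matrixP => i j; rewrite !mxE.
  by apply/CrealP/complex_realP; exists (g j i).
have yt : y^t* = U *m gC^t*.
  by rewrite trmx_mul map_mxM trmxCK.
have normE : toC ((g *m g^T) 0 0) = \sum_k `|y 0 k| ^+ 2.
  have -> : toC ((g *m g^T) 0 0) = (y *m y^t*) 0 0.
    rewrite yt mulmxA -(mulmxA gC).
    have -> : U^t* *m U = 1%:M.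
      by rewrite -invmx_unitary // mulVmx // unitarymx_unit.
    by rewrite mulmx1 gCt -map_mxM [RHS]mxE.
  by rewrite mxE; apply: eq_bigr => k _; rewrite !mxE normCK.
have formE : toC ((g *m H *m g^T) 0 0) = \sum_k d 0 k * `|y 0 k| ^+ 2.
  have -> : toC ((g *m H *m g^T) 0 0) = (y *m diag_mx d *m y^t*) 0 0.
    rewrite yt !mulmxA -(mulmxA gC) -(mulmxA gC (_ *m _)) -AE gCt.
    by rewrite -!map_mxM [RHS]mxE.
  rewrite mxE; apply: eq_bigr => k _; rewrite mul_mx_diag !mxE normCK.
  by rewrite mulrCA mulrA.
rewrite -lecR rmorphM /= normE formE mulr_sumr ler_sum // => k _.
have [x -> x_le] := eigen_d k.
by apply: ler_wpM2r; rewrite ?exprn_ge0 ?normr_ge0 ?lecR.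
Qed.

End RealSymmetric.

(** * Reversible kernels, Dirichlet forms and spectral gaps *)

Section Reversible.
Variables (R : realType) (T : finType) (S : {set T}) (w : T -> R).
Hypothesis w_gt0 : forall A, A \in S -> 0 < w A.

Definition reversible (P : T -> T -> R) :=
  forall A B, A \in S -> B \in S -> w A * P A B = w B * P B A.

Definition stochastic (P : T -> T -> R) :=
  forall A, A \in S -> \sum_(B in S) P A B = 1.

(** A right eigenvector of the restriction of P to S, extended arbitrarily to
    the whole type. *)
Definition eigenfunction (P : T -> T -> R) (x : R) (f : T -> R) :=
  (exists2 A, A \in S & f A != 0) /\
  forall A, A \in S -> \sum_(B in S) P A B * f B = x * f A.

Definition dirichlet (P : T -> T -> R) (f : T -> R) : R :=
  2^-1 * \sum_(A in S) \sum_(B in S) w A * P A B * (f A - f B) ^+ 2.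

Lemma sum_sqr_gt0 f : (exists2 A, A \in S & f A != 0) ->
  0 < \sum_(A in S) w A * f A ^+ 2.
Proof.
case=> A AS fA_neq0; rewrite (bigD1 A) //= ltr_pwDl //.
  by rewrite mulr_gt0 ?w_gt0 // exprn_even_gt0.
by apply: sumr_ge0 => B /andP [BS _]; rewrite mulr_ge0 ?sqr_ge0 // ltW ?w_gt0.
Qed.

Section Symmetrization.
Variable P : T -> T -> R.
Hypothesis revP : reversible P.

Let s (i : 'I_#|S|) := Num.sqrt (w (enum_val i)).

Let s_gt0 i : 0 < s i.
Proof. by rewrite sqrtr_gt0 w_gt0 // enum_valP. Qed.

Let s_neq0 i : s i != 0.
Proof. by rewrite gt_eqF. Qed.

Let sqr_s i : s i * s i = w (enum_val i).
Proof. by rewrite -expr2 sqr_sqrtr // ltW // w_gt0 // enum_valP. Qed.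

(** The conjugate of P by the diagonal matrix with entries sqrt (w A):
    detailed balance says exactly that it is symmetric. *)
Definition symmetrization : 'M[R]_#|S| :=
  \matrix_(i, j) (s i * P (enum_val i) (enum_val j) / s j).

Lemma symmetrization_sym : symmetrization^T = symmetrization.
Proof.
have entryE (i j : 'I_#|S|) : s i * P (enum_val i) (enum_val j) / s j =
    w (enum_val i) * P (enum_val i) (enum_val j) / (s i * s j).
  by rewrite -sqr_s; field; rewrite !s_neq0.
apply/matrixP => i j; rewrite !mxE !entryE revP ?enum_valP //.
by rewrite (mulrC (s i)).
Qed.

Lemma eigenvalue_symmetrization x :
  eigenvalue symmetrization x -> exists f, eigenfunction P x f.
Proof.
case/eigenvalueP => u uH u_neq0.
pose f A := \sum_(i < #|S|) (enum_val i == A)%:R * (u 0 i / s i).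
have fE i : f (enum_val i) = u 0 i / s i.
  rewrite /f (bigD1 i) //= eqxx mul1r big1 ?addr0 // => j ji.
  by rewrite (inj_eq enum_val_inj) (negPf ji) mul0r.
exists f; split.
  have /rV0Pn [i ui_neq0] := u_neq0.
  by exists (enum_val i); rewrite ?enum_valP // fE mulf_neq0 ?invr_neq0.
move=> A AS; rewrite -(enum_rankK_in AS AS); set i := enum_rank_in AS A.
rewrite big_enum_val fE mulrA.
move/rowP: uH => /(_ i); rewrite !mxE => <-; rewrite mulr_suml.
apply: eq_bigr => j _; rewrite fE.
have -> : symmetrization j i = symmetrization i j.
  by rewrite -[in LHS]symmetrization_sym mxE.
by rewrite mxE; field; rewrite !s_neq0.
Qed.

(** A complex left eigenvector v of P becomes the eigenvector v / sqrt w of the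
    symmetrization, whose spectrum is real. *)
Lemma kernel_eigenvalue_eigenfunction xi :
  eigenvalue (kernel_mx S P) xi ->
  exists x f, xi = real_complex R x /\ eigenfunction P x f.
Proof.
case/eigenvalueP => v vK v_neq0.
pose u := \row_j (v 0 j / real_complex R (s j)).
have sC_neq0 j : real_complex R (s j) != 0 by rewrite fmorph_eq0.
have [] := @real_sym_eigenvalue_real R _ symmetrization symmetrization_sym xi.
  apply/eigenvalueP; exists u.
    apply/rowP => j; rewrite !mxE.
    move/rowP: vK => /(_ j); rewrite !mxE mulrA => <-; rewrite mulr_suml.
    apply: eq_bigr => k _; rewrite !mxE !rmorphM /= fmorphV.
    by field; rewrite !sC_neq0.
  have /rV0Pn [i vi_neq0] := v_neq0.
  by apply/rV0Pn; exists i; rewrite mxE mulf_neq0 ?invr_neq0.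
by move=> x -> /eigenvalue_symmetrization [f fP]; exists x, f.
Qed.

(** By reversibility, w * f is a left eigenvector when f is a right one. *)
Lemma eigenfunction_kernel_eigenvalue x f : eigenfunction P x f ->
  eigenvalue (kernel_mx S P) (real_complex R x).
Proof.
case=> -[A AS fA_neq0] Pf.
have -> : kernel_mx S P =
    map_mx (real_complex R) (\matrix_(i, j) P (enum_val i) (enum_val j)).
  by apply/matrixP => i j; rewrite !mxE.
rewrite (eigenvalue_map (real_complex R)); apply/eigenvalueP.
exists (\row_i (w (enum_val i) * f (enum_val i))).
  apply/rowP => j; rewrite !mxE mulrCA -Pf ?enum_valP //.
  rewrite mulr_sumr [RHS]big_enum_val.
  apply: eq_bigr => i _; rewrite !mxE mulrAC revP ?enum_valP //.
  by rewrite mulrA.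
apply/rV0Pn; exists (enum_rank_in AS A); rewrite mxE enum_rankK_in //.
by rewrite mulf_neq0 // gt_eqF // w_gt0.
Qed.

(** The Rayleigh bound for the symmetrization at the vector sqrt w * g. *)
Lemma eigenfunction_form_le (s0 : R) :
  (forall x f, eigenfunction P x f -> x <= s0) -> forall g : T -> R,
  \sum_(A in S) \sum_(B in S) w A * P A B * (g A * g B) <=
    s0 * \sum_(A in S) w A * g A ^+ 2.
Proof.
move=> le_s0 g.
have le_H x : eigenvalue symmetrization x -> x <= s0.
  by case/eigenvalue_symmetrization => f /le_s0.
have := rayleigh_quotient_le symmetrization_sym le_H
  (\row_i (s i * g (enum_val i))).
have sgE :
    ((\row_i (s i * g (enum_val i))) *m
      (\row_i (s i * g (enum_val i)))^T) 0 0 = \sum_(A in S) w A * g A ^+ 2.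
  rewrite mxE [RHS]big_enum_val; apply: eq_bigr => i _; rewrite !mxE -sqr_s.
  by ring.
rewrite sgE; congr (_ <= _).
rewrite mxE [RHS]big_enum_val (eq_bigr (fun j => \sum_(i < #|S|)
  w (enum_val i) * P (enum_val i) (enum_val j) *
    (g (enum_val i) * g (enum_val j)))); last first.
  move=> j _; rewrite !mxE mulr_suml; apply: eq_bigr => i _.
  by rewrite !mxE -sqr_s; field; rewrite s_neq0.
by rewrite exchange_big; apply: eq_bigr => i _; rewrite [RHS]big_enum_val.
Qed.

End Symmetrization.

Section Stochastic.
Variable P : T -> T -> R.
Hypotheses (revP : reversible P) (stoP : stochastic P).

Lemma sum_stationary (f : T -> R) :
  \sum_(A in S) \sum_(B in S) w A * P A B * f B = \sum_(B in S) w B * f B.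
Proof.
rewrite exchange_big; apply: eq_bigr => B BS /=.
transitivity (\sum_(A in S) P B A * (w B * f B)).
  by apply: eq_bigr => A AS; rewrite revP // mulrAC mulrC.
by rewrite -mulr_suml stoP // mul1r.
Qed.

Lemma dirichletE f : dirichlet P f = \sum_(A in S) w A * f A ^+ 2 -
  \sum_(A in S) \sum_(B in S) w A * P A B * (f A * f B).
Proof.
have diagE : \sum_(A in S) \sum_(B in S) w A * P A B * f A ^+ 2 =
    \sum_(A in S) w A * f A ^+ 2.
  by apply: eq_bigr => A AS; rewrite -mulr_suml -mulr_sumr stoP // mulr1.
have -> : dirichlet P f = 2^-1 * (
    \sum_(A in S) \sum_(B in S) w A * P A B * f A ^+ 2 +
    \sum_(A in S) \sum_(B in S) w A * P A B * f B ^+ 2 -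
    2 * \sum_(A in S) \sum_(B in S) w A * P A B * (f A * f B)).
  rewrite /dirichlet; congr (_ * _); rewrite mulr_sumr -big_split -sumrB.
  apply: eq_bigr => A _ /=; rewrite mulr_sumr -big_split -sumrB.
  by apply: eq_bigr => B _ /=; ring.
by rewrite diagE sum_stationary; field.
Qed.

Lemma dirichlet_eigenfunction x f : eigenfunction P x f ->
  dirichlet P f = (1 - x) * \sum_(A in S) w A * f A ^+ 2.
Proof.
case=> _ Pf; rewrite dirichletE mulrBl mul1r; congr (_ - _).
rewrite mulr_sumr; apply: eq_bigr => A AS.
transitivity (w A * f A * \sum_(B in S) P A B * f B).
  by rewrite mulr_sumr; apply: eq_bigr => B _; ring.
by rewrite Pf //; ring.
Qed.

Lemma eigenfunction_mean0 x f : eigenfunction P x f -> x != 1 ->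
  \sum_(A in S) w A * f A = 0.
Proof.
case=> _ Pf x_neq1; apply/eqP; apply: contraNT x_neq1 => sum_neq0.
apply/eqP/(mulIf sum_neq0); rewrite mul1r mulr_sumr -[RHS]sum_stationary.
apply: eq_bigr => A AS; rewrite mulrCA -Pf // mulr_sumr.
by apply: eq_bigr => B _; rewrite mulrA.
Qed.

(** The operator P does not increase the weighted l1 norm. *)
Lemma eigenvalue_norm_le1 x f :
  (forall A B, A \in S -> B \in S -> 0 <= P A B) ->
  eigenfunction P x f -> `|x| <= 1.
Proof.
move=> P_ge0 [[A0 A0S fA0] Pf].
have norm_gt0 : 0 < \sum_(A in S) w A * `|f A|.
  rewrite (bigD1 A0) //= ltr_pwDl ?mulr_gt0 ?w_gt0 ?normr_gt0 //.
  by apply: sumr_ge0 => B /andP [BS _]; rewrite mulr_ge0 // ltW ?w_gt0.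
rewrite -(ler_pM2r norm_gt0) mul1r -[leRHS]sum_stationary mulr_sumr.
apply: ler_sum => A AS; rewrite mulrCA -normrM -Pf //.
have wA : 0 <= w A by rewrite ltW ?w_gt0.
apply: le_trans (ler_wpM2l wA (ler_norm_sum _ _ _)) _.
rewrite mulr_sumr; apply: ler_sum => B BS.
by rewrite normrM ger0_norm ?P_ge0 // mulrA.
Qed.

Lemma moduli_eigenfunction y : nontrivial_eigenvalue_moduli S P y ->
  exists x f, [/\ eigenfunction P x f, x != 1 & y = `|x|].
Proof.
case=> xi [/(kernel_eigenvalue_eigenfunction revP) [x [f [-> fP]]] x_neq1 yE].
exists x, f; split=> //.
  by apply: contraNneq x_neq1 => ->.
by move: yE; rewrite normc_def /= expr0n addr0 sqrtr_sqr => /complexI.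
Qed.

Lemma eigenfunction_moduli x f : eigenfunction P x f -> x != 1 ->
  nontrivial_eigenvalue_moduli S P `|x|.
Proof.
move=> /(eigenfunction_kernel_eigenvalue revP) xP x_neq1.
exists (real_complex R x); split=> //.
  by rewrite -(rmorph1 (real_complex R)) (inj_eq (@complexI R)).
by rewrite normc_def /= expr0n addr0 sqrtr_sqr.
Qed.

(** If there is no nontrivial eigenvalue, or no bound on them, the supremum is
    0 by convention. *)
Lemma sup_moduli_ge0 : 0 <= sup (nontrivial_eigenvalue_moduli S P).
Proof.
have [[[y yP] ub]|no_sup] := pselect (has_sup (nontrivial_eigenvalue_moduli S P)).
  have [x [f [_ _ yE]]] := moduli_eigenfunction yP.
  by apply: le_trans (ub_le_sup ub yP); rewrite yE normr_ge0.
by rewrite sup_out.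
Qed.

Lemma spectral_gap_le1 : spectral_gap S P <= 1.
Proof. by rewrite gerBl sup_moduli_ge0. Qed.

End Stochastic.

(** The kernel 2 P - 1 is again stochastic, so its eigenvalue 2 x - 1 has
    modulus at most 1. *)
Lemma lazy_eigenvalue_ge0 P x f : reversible P -> stochastic P ->
  (forall A B, A \in S -> B \in S -> A != B -> 0 <= P A B) ->
  (forall A, A \in S -> 2^-1 <= P A A) ->
  eigenfunction P x f -> 0 <= x.
Proof.
move=> revP stoP off_ge0 diag_ge [f_neq0 Pf].
pose Q A B := 2 * P A B - (B == A)%:R.
have sum_id (g : T -> R) A : A \in S -> \sum_(B in S) (B == A)%:R * g B = g A.
  move=> AS; rewrite (bigD1 A) //= eqxx mul1r big1 ?addr0 // => B /andP [_ BA].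
  by rewrite (negPf BA) mul0r.
have revQ : reversible Q.
  move=> A B AS BS; rewrite /Q !mulrBr !(mulrCA _ 2) revP //.
  by rewrite (eq_sym B); case: eqVneq => [->|_] //=; rewrite !mulr0.
have stoQ : stochastic Q.
  move=> A AS; rewrite /Q sumrB -mulr_sumr stoP //.
  rewrite (_ : \sum_(B in S) (B == A)%:R = 1); first by ring.
  by rewrite -[RHS](sum_id (fun=> 1) A AS); apply: eq_bigr => B _; rewrite mulr1.
have Q_ge0 A B : A \in S -> B \in S -> 0 <= Q A B.
  move=> AS BS; rewrite /Q; case: eqVneq => [->|BA] /=.
    by have := diag_ge A AS; lra.
  by have := off_ge0 A B AS BS; rewrite eq_sym BA => /(_ isT); lra.
have : eigenfunction Q (2 * x - 1) f.
  split=> // A AS; rewrite /Q.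
  under eq_bigr do rewrite mulrBl -mulrA.
  by rewrite sumrB -mulr_sumr Pf // sum_id //; ring.
by move/(eigenvalue_norm_le1 revQ stoQ Q_ge0); rewrite ler_norml; lra.
Qed.

(** At an eigenfunction for x the Poincare inequality reads k <= 1 - x, and
    laziness makes x equal to its modulus.  The condition k <= 1 covers the
    case of an empty set of nontrivial eigenvalues, where the gap is 1. *)
Lemma spectral_gap_ge P (k : R) : reversible P -> stochastic P ->
  (forall A B, A \in S -> B \in S -> A != B -> 0 <= P A B) ->
  (forall A, A \in S -> 2^-1 <= P A A) ->
  k <= 1 ->
  (forall f, \sum_(A in S) w A * f A = 0 ->
    k * \sum_(A in S) w A * f A ^+ 2 <= dirichlet P f) ->
  k <= spectral_gap S P.
Proof.
move=> revP stoP off_ge0 diag_ge k_le1 poincare.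
rewrite /spectral_gap lerBrDr -lerBrDl.
have [[y0 y0P]|empty] := pselect (nontrivial_eigenvalue_moduli S P !=set0)%classic;
    last first.
  by rewrite sup_out ?subr_ge0 // => -[].
apply: ge_sup; first by exists y0.
move=> y /(moduli_eigenfunction revP) [x [f [fP x_neq1 ->]]].
rewrite ger0_norm; last by apply: lazy_eigenvalue_ge0 fP.
have := poincare f (eigenfunction_mean0 revP stoP fP x_neq1).
rewrite (dirichlet_eigenfunction revP stoP fP) ler_pM2r; first by lra.
by apply: sum_sqr_gt0; case: fP.
Qed.

(** The kernel is deflated: subtracting the projection onto constants,
    A, B |-> w B / W, leaves the quadratic form unchanged on functions of mean
    zero and replaces the eigenvalue 1 of the constants by 0.  As 1 is simple,
    the eigenvalues of the deflated kernel are 0 and nontrivial eigenvalues of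
    P, and the Rayleigh bound for the deflated kernel concludes. *)
Lemma spectral_gap_poincare P : reversible P -> stochastic P ->
  (forall A B, A \in S -> B \in S -> 0 < P A B) ->
  forall f, \sum_(A in S) w A * f A = 0 ->
  spectral_gap S P * \sum_(A in S) w A * f A ^+ 2 <= dirichlet P f.
Proof.
move=> revP stoP P_gt0 f mean0.
pose W := \sum_(A in S) w A; pose Q A B := P A B - w B / W.
have revQ : reversible Q.
  by move=> A B AS BS; rewrite /Q !mulrBr revP // mulrCA.
have deflE (h : T -> R) A : \sum_(B in S) Q A B * h B =
    \sum_(B in S) P A B * h B - (\sum_(B in S) w B * h B) / W.
  rewrite mulr_suml -sumrB; apply: eq_bigr => B _.
  by rewrite /Q mulrBl (mulrAC (w B)).
set s := sup (nontrivial_eigenvalue_moduli S P).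
have le_s x h : eigenfunction Q x h -> x <= s.
  case=> h_neq0 Qh.
  (* Applying the deflated kernel always produces a function of mean zero. *)
  have mean_h : x * (\sum_(A in S) w A * h A) = 0.
    rewrite mulr_sumr.
    transitivity (\sum_(A in S) (\sum_(B in S) w A * P A B * h B -
        w A / W * \sum_(B in S) w B * h B)).
      apply: eq_bigr => A AS; rewrite mulrCA -Qh // deflE mulrBr.
      congr (_ - _); last by rewrite mulrCA mulrC.
      by rewrite mulr_sumr; apply: eq_bigr => B _; rewrite mulrA.
    rewrite sumrB sum_stationary // -mulr_suml -mulr_suml divff ?mul1r ?subrr //.
    rewrite gt_eqF // /W; have [A AS _] := h_neq0.
    rewrite (bigD1 A) //= ltr_pwDl ?w_gt0 //.
    by apply: sumr_ge0 => B /andP [BS _]; rewrite ltW ?w_gt0.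
  have [->|x_neq0] := eqVneq x 0; first exact: sup_moduli_ge0.
  have {}mean_h : \sum_(A in S) w A * h A = 0.
    by apply/eqP; move/eqP: mean_h; rewrite mulf_eq0 (negPf x_neq0).
  have hP : eigenfunction P x h.
    by split=> // A AS; rewrite -Qh // deflE mean_h mul0r subr0.
  (* Simplicity of 1: a harmonic function has Dirichlet form 0, so it is
     constant because the entries of P are positive. *)
  have x_neq1 : x != 1.
    apply/eqP => x1; have [A AS /negP[]] := h_neq0.
    have := dirichlet_eigenfunction revP stoP hP.
    rewrite x1 subrr mul0r => /eqP; rewrite mulf_eq0 invr_eq0 pnatr_eq0 /=.
    have term_ge0 C D : C \in S -> D \in S -> 0 <= w C * P C D * (h C - h D) ^+ 2.
      by move=> CS DS; rewrite mulr_ge0 ?sqr_ge0 // mulr_ge0 // ltW ?w_gt0 ?P_gt0.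
    rewrite psumr_eq0; last by move=> C CS; apply: sumr_ge0 => D; apply: term_ge0.
    move/allP => /(_ A (mem_index_enum _)); rewrite AS /=.
    rewrite psumr_eq0; last by move=> D; apply: term_ge0.
    move/allP => hconst.
    have hE B : B \in S -> h B = h A.
      move=> BS; have := hconst B (mem_index_enum _); rewrite BS /= mulf_eq0.
      by rewrite gt_eqF ?mulr_gt0 ?w_gt0 ?P_gt0 //= expf_eq0 subr_eq0 => /eqP.
    move: mean_h; rewrite (eq_bigr (fun B => w B * h A)); last first.
      by move=> B BS; rewrite hE.
    rewrite -mulr_suml => /eqP; rewrite mulf_eq0 => /orP[|//].
    rewrite gt_eqF // (bigD1 A) //= ltr_pwDl ?w_gt0 //.
    by apply: sumr_ge0 => B /andP [BS _]; rewrite ltW ?w_gt0.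
  apply: le_trans (ler_norm x) _; apply: ub_le_sup; last first.
    exact: eigenfunction_moduli hP x_neq1.
  exists 1 => y /(moduli_eigenfunction revP) [z [g [gP _ ->]]].
  apply: eigenvalue_norm_le1 gP => // C D CS DS; exact/ltW/P_gt0.
rewrite dirichletE // mulrBl mul1r lerB //.
apply: le_trans (eigenfunction_form_le revQ le_s f).
have -> : \sum_(A in S) \sum_(B in S) w A * Q A B * (f A * f B) =
    \sum_(A in S) \sum_(B in S) w A * P A B * (f A * f B) -
    (\sum_(A in S) w A * f A) * (\sum_(B in S) w B * f B) / W.
  rewrite -mulrA mulr_suml -sumrB; apply: eq_bigr => A _.
  rewrite mulr_suml mulr_sumr -sumrB; apply: eq_bigr => B _.
  by rewrite /Q; ring.
by rewrite mean0 !mul0r subr0.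
Qed.

End Reversible.

(** * The Efron-Stein inequality for independent percolation *)

Lemma set_add_ind (T : finType) (P : {set T} -> Prop) :
  P finset.set0 -> (forall x (A : {set T}), x \notin A -> P A -> P (x |: A)) ->
  forall A, P A.
Proof.
move=> P0 PU A; have [n] := ubnP #|A|; elim: n A => // n IH A cA.
have [->//|[x xA]] := set_0Vmem A.
rewrite -(finset.setD1K xA); apply: PU; first by rewrite setD11.
by apply: IH; rewrite (cardsD1 x) xA in cA.
Qed.

Section Percolation.
Variables (R : realType) (T : finType) (p : R).
Hypotheses (p_gt0 : 0 < p) (p_lt1 : p < 1).
Implicit Types (F A B : {set T}) (f g : {set T} -> R).

Local Notation odds := (p / (1 - p)).

Lemma big_powersetU1 x F g : x \notin F ->
  \sum_(A in powerset (x |: F)) g A =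
    \sum_(A in powerset F) (g A + g (x |: A)).
Proof.
move=> xF; rewrite (bigID (fun A => x \in A)) /= addrC big_split /=.
congr (_ + _).
  apply: eq_bigl => A; rewrite !powersetE.
  apply/andP/idP => [[AxF xA]|AF].
    apply/fintype.subsetP => y yA; move/fintype.subsetP: AxF => /(_ y yA).
    by rewrite in_setU1 => /orP [/eqP yx|//]; rewrite -yx yA in xA.
  split; first exact: fintype.subset_trans AF (finset.subsetUr _ _).
  by apply: contra xF; apply: (fintype.subsetP AF).
rewrite (reindex_onto (fun A => x |: A) (fun A => A :\ x)) /=; last first.
  by move=> A /andP [_ xA]; rewrite finset.setD1K.
apply: eq_bigl => A; rewrite !powersetE setU11 andbT.
apply/andP/idP => [[sAF /eqP Ax]|AF].
  rewrite -Ax; apply/fintype.subsetP => y; rewrite !inE => /andP [yx].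
  rewrite (negPf yx) /= => yA; move/fintype.subsetP: sAF => /(_ y).
  by rewrite !inE yA (negPf yx) orbT => /(_ isT).
split; first by rewrite finset.setUS.
by rewrite setU1K //; apply: contra xF; apply: (fintype.subsetP AF).
Qed.

(** The expectation of f at a random subset of F that contains each element
    independently with probability p: the probability
    p^|A| * (1 - p)^(|F| - |A|) of A is (1 - p)^|F| * (p / (1 - p))^|A|. *)
Definition percolation_mean F f : R :=
  (1 - p) ^+ #|F| * \sum_(A in powerset F) odds ^+ #|A| * f A.

(** Conditioning on whether x belongs to the random set. *)
Lemma percolation_meanU1 x F f : x \notin F ->
  percolation_mean (x |: F) f =
    p * percolation_mean F (fun A => f (x |: A)) +
    (1 - p) * percolation_mean F f.
Proof.
move=> xF; rewrite /percolation_mean big_powersetU1 // cardsU1 xF exprS.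
have q_neq0 : 1 - p != 0 by rewrite subr_eq0 gt_eqF.
rewrite big_split /= addrC mulrDr; congr (_ + _); last by ring.
rewrite (eq_bigr (fun A => odds * (odds ^+ #|A| * f (x |: A)))); last first.
  move=> A; rewrite powersetE => AF; rewrite cardsU1.
  have -> : x \notin A by apply: contra xF; apply: (fintype.subsetP AF).
  by rewrite exprS -mulrA.
by rewrite -mulr_sumr; field.
Qed.

Lemma percolation_mean0 f : percolation_mean finset.set0 f = f finset.set0.
Proof.
rewrite /percolation_mean cards0 expr0 mul1r powerset0 big_set1 cards0.
by rewrite expr0 mul1r.
Qed.

Lemma eq_percolation_mean F f g : (forall A, A \subset F -> f A = g A) ->
  percolation_mean F f = percolation_mean F g.
Proof.
move=> fg; rewrite /percolation_mean; congr (_ * _).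
apply: eq_bigr => A; rewrite powersetE => AF.
by rewrite fg.
Qed.

Lemma percolation_meanZ F c f :
  percolation_mean F (fun A => c * f A) = c * percolation_mean F f.
Proof.
rewrite /percolation_mean [RHS]mulrCA; congr (_ * _); rewrite mulr_sumr.
by apply: eq_bigr => A _; rewrite mulrCA.
Qed.

Lemma percolation_meanD F f g :
  percolation_mean F (fun A => f A + g A) =
    percolation_mean F f + percolation_mean F g.
Proof.
rewrite /percolation_mean -mulrDr -big_split; congr (_ * _).
by apply: eq_bigr => A _; rewrite mulrDr.
Qed.

Lemma percolation_mean_cst F c : percolation_mean F (fun=> c) = c.
Proof.
elim/set_add_ind: F => [|x F xF IH]; first by rewrite percolation_mean0.
by rewrite percolation_meanU1 // IH; ring.
Qed.

Definition percolation_var F f : R :=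
  percolation_mean F (fun A => f A ^+ 2) - percolation_mean F f ^+ 2.

Lemma percolation_var_sum F f : percolation_var F f = 2^-1 *
  percolation_mean F (fun A => percolation_mean F (fun B => (f A - f B) ^+ 2)).
Proof.
set m2 := percolation_mean F (fun A => f A ^+ 2); set m1 := percolation_mean F f.
have innerE A : percolation_mean F (fun B => (f A - f B) ^+ 2) =
    f A ^+ 2 + (m2 + - 2 * m1 * f A).
  rewrite (@eq_percolation_mean F _
    (fun B => f A ^+ 2 + (f B ^+ 2 + - 2 * f A * f B))); last by move=> B _; ring.
  rewrite !percolation_meanD percolation_mean_cst.
  by rewrite (percolation_meanZ F (- 2 * f A) f) -/m1 -/m2; ring.
rewrite (eq_percolation_mean (fun A _ => innerE A)).
rewrite !percolation_meanD percolation_mean_cst.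
rewrite (percolation_meanZ F (- 2 * m1) f).
by rewrite -/m1 -/m2 /percolation_var -/m1 -/m2; field.
Qed.

Lemma percolation_mean_ge0 F f : (forall A, 0 <= f A) ->
  0 <= percolation_mean F f.
Proof.
move=> f_ge0; have q_gt0 : 0 < 1 - p by rewrite subr_gt0.
apply: mulr_ge0; first by rewrite exprn_ge0 ?ltW.
apply: sumr_ge0 => A _.
by rewrite mulr_ge0 // exprn_ge0 // divr_ge0 // ltW.
Qed.

Lemma percolation_var_ge0 F f : 0 <= percolation_var F f.
Proof.
rewrite percolation_var_sum mulr_ge0 ?invr_ge0 //.
by do 2![apply: percolation_mean_ge0 => ?]; apply: sqr_ge0.
Qed.

(** The increment of f at x does not depend on the presence of x, so x can be
    dropped from the ground set. *)
Lemma percolation_mean_increment x F f c : x \in F ->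
  percolation_mean F (fun A => c * (f (x |: A) - f (A :\ x)) ^+ 2) =
    c * percolation_mean (F :\ x) (fun A => (f (x |: A) - f A) ^+ 2).
Proof.
move=> xF; rewrite -{1}(finset.setD1K xF) percolation_meanU1 ?setD11 //.
have meanE (B : {set T} -> {set T}) :
    (forall A, x \notin A -> x |: B A = x |: A /\ B A :\ x = A) ->
    percolation_mean (F :\ x)
      (fun A => c * (f (x |: B A) - f (B A :\ x)) ^+ 2) =
    c * percolation_mean (F :\ x) (fun A => (f (x |: A) - f A) ^+ 2).
  move=> BE; rewrite -percolation_meanZ; apply: eq_percolation_mean => A.
  by rewrite subsetD1 => /andP [_ /BE [-> ->]].
rewrite (meanE (fun A => x |: A)) ?(meanE id); first by ring.
- move=> A xA; split=> //; apply/finset.setP => y; rewrite !inE.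
  by case: eqVneq => //= ->; rewrite (negPf xA).
- by move=> A xA; rewrite setU1K // finset.setUA finset.setUid.
Qed.

(** Induction on F.  Conditioning on the presence of a new element x splits the
    variance into the average of two conditional variances, handled by the
    induction hypothesis, and p (1 - p) times the square of the mean increment
    at x, which is at most the mean of the squared increment. *)
Lemma efron_stein F f : percolation_var F f <= \sum_(x in F)
  percolation_mean F (fun A => p * (1 - p) * (f (x |: A) - f (A :\ x)) ^+ 2).
Proof.
elim/set_add_ind: F f => [|x F xF IH] f.
  by rewrite big_set0 /percolation_var !percolation_mean0 subrr.
pose f1 A := f (x |: A).
have varE : percolation_var (x |: F) f =
    p * percolation_var F f1 + (1 - p) * percolation_var F f +
    p * (1 - p) * percolation_mean F (fun A => f1 A - f A) ^+ 2.
  rewrite /percolation_var !percolation_meanU1 //.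
  have -> : percolation_mean F (fun A => f1 A - f A) =
      percolation_mean F f1 - percolation_mean F f.
    rewrite -[- _]mulN1r -percolation_meanZ -percolation_meanD.
    by apply: eq_percolation_mean => A _; rewrite mulN1r.
  by rewrite -/f1; ring.
have jensen : percolation_mean F (fun A => f1 A - f A) ^+ 2 <=
    percolation_mean F (fun A => (f1 A - f A) ^+ 2).
  by rewrite -subr_ge0; apply: percolation_var_ge0.
rewrite varE big_setU1 //= [leRHS]addrC; apply: lerD; last first.
  rewrite percolation_mean_increment ?setU11 // setU1K //.
  have pp_ge0 : 0 <= p * (1 - p) by rewrite mulr_ge0 ?subr_ge0 // ltW.
  by have := ler_wpM2l pp_ge0 jensen; lra.
have q_gt0 : 0 < 1 - p by rewrite subr_gt0.
under eq_bigr do rewrite percolation_meanU1 //.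
have sumE c (g : T -> {set T} -> R) : \sum_(e in F) c * percolation_mean F (g e) =
    c * \sum_(e in F) percolation_mean F (g e) by rewrite mulr_sumr.
rewrite big_split /= !sumE; apply: lerD; rewrite ler_pM2l //.
apply: le_trans (IH f1) _; apply: ler_sum => e eF.
rewrite le_eqVlt; apply/orP; left; apply/eqP.
apply: eq_percolation_mean => A AF; congr (_ * (_ - _) ^+ 2).
  by rewrite /f1 finset.setUCA.
rewrite /f1; congr f; apply/finset.setP => y; rewrite !inE.
case: eqVneq => //= ->; case: eqVneq => // xe; by rewrite xe eF in xF.
Qed.

End Percolation.

(** * Compatible colourings and connected components *)

Section Colourings.
Variables (V : finType) (E : {set {set V}}) (q : nat).
Hypothesis simpleE : forall e : {set V}, e \in E -> #|e| = 2%N.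
Implicit Types A B : {set {set V}}.

Lemma mono_edgesP A (sigma : {ffun V -> 'I_q}) : A \subset E ->
  reflect (forall u v, edge_rel A u v -> sigma u = sigma v)
    (A \subset mono_edges E sigma).
Proof.
move=> sAE; apply: (iffP fintype.subsetP) => [mono u v uvA|mono e eA].
  move: (mono _ uvA); rewrite inE => /andP [_ /forallP /(_ u)].
  by rewrite finset.set21 => /forallP /(_ v); rewrite set22 => /eqP.
rewrite inE (fintype.subsetP sAE) //=.
apply/forallP => u; apply/implyP => ue; apply/forallP => v; apply/implyP => ve.
have [->//|uv] := eqVneq u v.
suff uvA : edge_rel A u v by rewrite (mono _ _ uvA).
rewrite /edge_rel; suff -> : [set u; v]%SET = e by [].
apply/eqP; rewrite eqEcard finset.subUset !finset.sub1set ue ve /= cards2 uv.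
by rewrite (simpleE (fintype.subsetP sAE _ eA)).
Qed.

(** A compatible colouring is constant on components, hence determined by
    arbitrary values at the canonical representatives of the components. *)
Lemma card_compatible_colourings A : A \subset E ->
  #|[set sigma : {ffun V -> 'I_q} | A \subset mono_edges E sigma]%SET| =
  (q ^ components A)%N.
Proof.
move=> sAE; set e := edge_rel A.
have sym_e : connect_sym e.
  by apply: sym_connect_sym => u v; rewrite /e /edge_rel finset.setUC.
pose I := {x : V | x \in roots e}.
pose rt v : I := exist _ (fingraph.root e v) (fingraph.roots_root sym_e v).
pose h (tau : {ffun I -> 'I_q}) : {ffun V -> 'I_q} := [ffun v => tau (rt v)].
have h_inj : injective h.
  move=> t1 t2 /ffunP t12; apply/ffunP => -[x xr].
  move: (t12 x); rewrite !ffunE; congr (t1 _ = t2 _); apply: val_inj => /=;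
  exact/eqP.
have -> : [set sigma | A \subset mono_edges E sigma]%SET = h @: finset.setT.
  apply/finset.setP => sigma; rewrite inE.
  apply/(mono_edgesP _ sAE)/imsetP => [mono|[tau _ ->] u v uv].
    have pathE s u : path e u s -> sigma u = sigma (last u s).
      by elim: s u => [|z s IH] u //= /andP [/mono -> /IH].
    exists [ffun x : I => sigma (val x)]; first by rewrite inE.
    apply/ffunP => v; rewrite !ffunE /=.
    have /connectP [s /pathE -> ->] := fingraph.connect_root e v.
    by [].
  rewrite !ffunE; congr (tau _); apply: val_inj => /=.
  by apply/eqP; rewrite (fingraph.root_connect sym_e) connect1.
rewrite card_imset // cardsT card_ffun card_ord card_sig; congr (q ^ _)%N.
by rewrite /components /n_comp_mem; apply: eq_card => x; rewrite !inE andbT.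
Qed.

End Colourings.

(** * The Swendsen-Wang and heat-bath Dirichlet forms *)

Section RandomClusterDynamics.
Variables (R : realType) (V : finType) (E : {set {set V}}) (p : R) (q : nat).
Hypothesis simpleE : forall e : {set V}, e \in E -> #|e| = 2%N.
Hypotheses (p_gt0 : 0 < p) (p_lt1 : p < 1) (q_ge1 : (1 <= q)%N).
Implicit Types A B : {set {set V}}.

Local Notation odds := (p / (1 - p)).
Local Notation w := (rc_weight p q).
Local Notation mono := (mono_edges E).
Local Notation Omega := (powerset E).

Lemma odds_gt0 : 0 < odds.
Proof. by rewrite divr_gt0 // subr_gt0. Qed.

Lemma rc_weight_gt0 A : 0 < w A.
Proof. by rewrite mulr_gt0 ?exprn_gt0 ?odds_gt0 ?ltr0n. Qed.

Lemma rc_weight_ge0 A : 0 <= w A.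
Proof. exact/ltW/rc_weight_gt0. Qed.

(** The random-cluster weight is the marginal of a joint weight on pairs of a
    colouring and a set of monochromatic edges. *)
Lemma rc_weight_colourings A : A \subset E ->
  w A = odds ^+ #|A| * \sum_(sigma : {ffun V -> 'I_q}) (A \subset mono sigma)%:R.
Proof.
move=> sAE; rewrite /rc_weight -natrX -(card_compatible_colourings q simpleE sAE).
congr (_ * _); rewrite -sum1_card natr_sum big_mkcond /=.
by apply: eq_bigr => sigma _; rewrite inE; case: (_ \subset _).
Qed.

Lemma mono_edges_sub (sigma : {ffun V -> 'I_q}) : mono sigma \subset E.
Proof. by apply/fintype.subsetP => e; rewrite inE => /andP []. Qed.

Lemma sum_powerset_sub (E' F : {set {set V}}) (g : {set {set V}} -> R) :
  F \subset E' ->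
  \sum_(B in powerset E') (B \subset F)%:R * g B = \sum_(B in powerset F) g B.
Proof.
move=> sFE; rewrite (bigID (fun B => B \subset F)) /= [X in _ + X]big1 ?addr0.
  apply: eq_big => B.
    rewrite !powersetE andbC; case: (boolP (B \subset F)) => //= BF.
    exact: fintype.subset_trans BF sFE.
  by move=> /andP [_ ->]; rewrite mul1r.
by move=> B /andP [_ /negPf ->]; rewrite mul0r.
Qed.

(** The factor q^-c(A) of the kernel cancels against the weight.  What remains
    is symmetric, and for fixed sigma factors as a product over A and B. *)
Lemma sw_flowE A B : w A * P_SW E p q A B = \sum_(sigma : {ffun V -> 'I_q})
  (1 - p) ^+ #|mono sigma| * ((A \subset mono sigma)%:R * odds ^+ #|A|) *
    ((B \subset mono sigma)%:R * odds ^+ #|B|).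
Proof.
have q_neq0 : q%:R ^+ components A != 0 :> R.
  by rewrite expf_neq0 // pnatr_eq0 -lt0n.
rewrite /rc_weight /P_SW; set colourings := \sum_sigma _.
rewrite (_ : _ * _ = odds ^+ #|A| * odds ^+ #|B| * colourings); last first.
  by rewrite !mulrA mulfK.
rewrite /colourings mulr_sumr; apply: eq_bigr => sigma _; rewrite finset.subUset.
case: (A \subset _); case: (B \subset _); rewrite ?(mulr0, mul0r) //= !mul1r mulr1.
by rewrite mulrC mulrA.
Qed.

Lemma sw_reversible : reversible Omega w (P_SW E p q).
Proof.
by move=> A B _ _; rewrite !sw_flowE; apply: eq_bigr => sigma _; rewrite mulrAC.
Qed.

Lemma sw_stochastic : stochastic Omega (P_SW E p q).
Proof.
move=> A; rewrite powersetE => sAE.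
apply: (mulfI (lt0r_neq0 (rc_weight_gt0 A))).
rewrite mulr1 mulr_sumr; under eq_bigr do rewrite sw_flowE.
rewrite exchange_big /= rc_weight_colourings // mulr_sumr.
apply: eq_bigr => sigma _; rewrite -mulr_sumr sum_powerset_sub ?mono_edges_sub //.
have := percolation_mean_cst p_lt1 (mono sigma) 1.
rewrite /percolation_mean; under eq_bigr do rewrite mulr1.
by move=> sum1; rewrite mulrAC sum1 mul1r mulrC.
Qed.

(** Constant colourings make every transition possible. *)
Lemma sw_gt0 A B : A \in Omega -> B \in Omega -> 0 < P_SW E p q A B.
Proof.
rewrite !powersetE => sAE sBE.
have p1_gt0 : 0 < 1 - p by rewrite subr_gt0.
rewrite -(pmulr_rgt0 _ (rc_weight_gt0 A)) sw_flowE.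
have /card_gt0P [c _] : (0 < #|'I_q|)%N by rewrite card_ord.
rewrite (bigD1 [ffun=> c]) //= ltr_pwDl //.
  have monoE : mono [ffun=> c] = E.
    apply/finset.setP => e; rewrite inE andbC.
    case: forallP => // -[] u; apply/implyP => _; apply/forallP => v.
    by rewrite !ffunE eqxx implybT.
  by rewrite monoE sAE sBE !mul1r !mulr_gt0 ?exprn_gt0 ?odds_gt0.
apply: sumr_ge0 => sigma _.
by rewrite !mulr_ge0 ?exprn_ge0 ?ler0n // ltW // odds_gt0.
Qed.

(** Given sigma, the two endpoints of a Swendsen-Wang transition are independent
    percolations on the monochromatic edges; the normalisation leaves the
    factor (1 - p)^-|E(sigma)|. *)
Lemma dirichlet_sw f : dirichlet Omega w (P_SW E p q) f =
  \sum_(sigma : {ffun V -> 'I_q})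
    (1 - p) ^- #|mono sigma| * percolation_var p (mono sigma) f.
Proof.
have p1_neq0 : 1 - p != 0 by rewrite subr_eq0 gt_eqF.
transitivity (2^-1 * \sum_(sigma : {ffun V -> 'I_q}) (1 - p) ^+ #|mono sigma| *
    \sum_(A in powerset (mono sigma)) \sum_(B in powerset (mono sigma))
      odds ^+ #|A| * (odds ^+ #|B| * (f A - f B) ^+ 2)).
  rewrite /dirichlet; congr (_ * _).
  under eq_bigr do under eq_bigr do rewrite sw_flowE mulr_suml.
  under eq_bigr do rewrite exchange_big /=.
  rewrite exchange_big; apply: eq_bigr => sigma _ /=.
  rewrite mulr_sumr -(sum_powerset_sub _ (mono_edges_sub sigma)).
  apply: eq_bigr => A _; rewrite -(sum_powerset_sub _ (mono_edges_sub sigma)).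
  rewrite !mulr_sumr; apply: eq_bigr => B _.
  by move: #|mono sigma| #|A| #|B| => k a b; ring.
rewrite mulr_sumr; apply: eq_bigr => sigma _.
rewrite (percolation_var_sum p_lt1) [RHS]mulrCA; congr (_ * _).
rewrite /percolation_mean mulrA mulVf ?expf_neq0 // mul1r mulr_sumr.
apply: eq_bigr => A _; rewrite mulrCA; congr (_ * _).
by rewrite mulr_sumr.
Qed.

(** Efron-Stein for each colouring; then the sum over colourings is carried out
    first and rebuilds the weight of e |: A. *)
Lemma dirichlet_sw_le f : dirichlet Omega w (P_SW E p q) f <=
  \sum_(e in E) \sum_(A in powerset (E :\ e))
    (1 - p) * w (e |: A) * (f (e |: A) - f A) ^+ 2.
Proof.
have p1_gt0 : 0 < 1 - p by rewrite subr_gt0.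
have p1_neq0 : 1 - p != 0 by rewrite gt_eqF.
rewrite dirichlet_sw.
apply: (@le_trans _ _ (\sum_(sigma : {ffun V -> 'I_q}) \sum_(e in mono sigma)
    p * \sum_(A in powerset (mono sigma :\ e))
      odds ^+ #|A| * (f (e |: A) - f A) ^+ 2)).
  apply: ler_sum => sigma _; set F := mono sigma.
  rewrite mulrC ler_pdivrMr ?exprn_gt0 //.
  apply: le_trans (efron_stein p_gt0 p_lt1 F f) _.
  rewrite mulr_suml le_eqVlt; apply/orP; left; apply/eqP.
  apply: eq_bigr => e eF.
  rewrite percolation_mean_increment //.
  rewrite (cardsD1 e F) eF exprS /percolation_mean.
  by move: #|F :\ e| (\sum_(A in _) _) => k total; ring.
rewrite le_eqVlt; apply/orP; left; apply/eqP.
transitivity (\sum_(sigma : {ffun V -> 'I_q}) \sum_(e in E)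
    \sum_(A in powerset (E :\ e)) (e |: A \subset mono sigma)%:R *
      (p * odds ^+ #|A| * (f (e |: A) - f A) ^+ 2)).
  apply: eq_bigr => sigma _; set F := mono sigma.
  rewrite [RHS](bigID (fun e => e \in F)) /= [X in _ = _ + X]big1 ?addr0.
    apply: eq_big => e.
      rewrite andbC; case: (boolP (e \in F)) => //=.
      by move/(fintype.subsetP (mono_edges_sub sigma)).
    move=> eF; rewrite mulr_sumr.
    rewrite -(sum_powerset_sub _ (finset.setSD [set e]%SET (mono_edges_sub sigma))).
    apply: eq_bigr => A; rewrite powersetE subsetD1 => /andP [_ eA].
    by rewrite subsetD1 eA andbT finset.subUset finset.sub1set eF /= !mulrA.
  move=> e /andP [_ eF]; apply: big1 => A _.
  by rewrite finset.subUset finset.sub1set (negPf eF) mul0r.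
rewrite exchange_big; apply: eq_bigr => e eE /=.
rewrite exchange_big; apply: eq_bigr => A.
rewrite powersetE subsetD1 => /andP [sAE eA].
rewrite -mulr_suml rc_weight_colourings; last first.
  by rewrite finset.subUset finset.sub1set eE.
rewrite cardsU1 eA add1n [odds ^+ _.+1]exprS; move: #|A| (\sum_sigma _) => k total.
by field.
Qed.

(** The equilibrium flow of the heat-bath update of e; both configurations must
    agree off e. *)
Definition hb_flow (e : {set V}) A B : R :=
  w A * w B / (w (e |: A) + w (A :\ e)) * (B :\ e == A :\ e)%:R.

Lemma symdiff_sub1 (e : {set V}) A B :
  ((A :\: B) :|: (B :\: A) \subset [set e]) = (B :\ e == A :\ e).
Proof.
apply/fintype.subsetP/eqP => [sub|AB x].
  apply/finset.setP => x; have := sub x; rewrite !inE.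
  by case: eqVneq => //= _; case: (x \in A); case: (x \in B) => //= /(_ isT).
by move/finset.setP/(_ x): AB; rewrite !inE; case: eqVneq => //= _ ->;
  case: (x \in A).
Qed.

(** The partition function cancels between numerator and denominator. *)
Lemma hb_moveE A B :
  w A * hb_move E p q A B = (2 * #|E|%:R)^-1 * \sum_(e in E) hb_flow e A B.
Proof.
have Z_gt0 : 0 < \sum_(C in Omega) w C.
  rewrite (bigD1 E) ?powersetE //= ltr_pwDl ?rc_weight_gt0 //.
  by apply: sumr_ge0 => C _; apply: rc_weight_ge0.
rewrite /hb_move mulrCA mulr_sumr; congr (_ * _); apply: eq_bigr => e _.
rewrite symdiff_sub1 /hb_flow mulrA; congr (_ * _).
rewrite /rc_measure -mulrDl; field.
by rewrite !gt_eqF ?addr_gt0 ?rc_weight_gt0.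
Qed.

Lemma hb_flow_sym e A B : hb_flow e A B = hb_flow e B A.
Proof.
rewrite /hb_flow eq_sym; case: eqVneq => [AB|]; last by rewrite !mulr0.
have -> : e |: A = e |: B.
  apply/finset.setP => x; move/finset.setP/(_ x): AB; rewrite !inE.
  by case: eqVneq => //= _ ->.
by rewrite AB (mulrC (w A)).
Qed.

Lemma weight_ratio_ge0 A B (A' B' : {set {set V}}) :
  0 <= w A * w B / (w A' + w B').
Proof.
have wA := rc_weight_ge0 A; have wB := rc_weight_ge0 B.
have wA' := rc_weight_ge0 A'; have wB' := rc_weight_ge0 B'.
by apply: divr_ge0; [exact: mulr_ge0 | exact: addr_ge0].
Qed.

Lemma hb_flow_ge0 e A B : 0 <= hb_flow e A B.
Proof.
by apply: mulr_ge0; [exact: weight_ratio_ge0 | exact: ler0n].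
Qed.

Lemma hb_move_ge0 A B : 0 <= hb_move E p q A B.
Proof.
rewrite -(pmulr_rge0 _ (rc_weight_gt0 A)) hb_moveE.
apply: mulr_ge0; first by rewrite invr_ge0 mulr_ge0 ?ler0n.
by apply: sumr_ge0 => e _; apply: hb_flow_ge0.
Qed.

Lemma sum_split_edge e (g : {set {set V}} -> R) : e \in E ->
  \sum_(A in Omega) g A = \sum_(A in powerset (E :\ e)) (g A + g (e |: A)).
Proof. by move=> eE; rewrite -{1}(finset.setD1K eE) big_powersetU1 ?setD11. Qed.

Lemma sum_update e A (g : {set {set V}} -> R) : e \in E -> A \subset E ->
  \sum_(B in Omega) (B :\ e == A :\ e)%:R * g B = g (A :\ e) + g (e |: A).
Proof.
move=> eE sAE; rewrite (sum_split_edge _ eE).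
rewrite (bigD1 (A :\ e)) ?powersetE ?finset.setSD //=.
have notin_id B : e \notin B -> B :\ e = B.
  move=> eB; apply/finset.setP => y; rewrite !inE.
  by case: eqVneq => //= ->; rewrite (negPf eB).
rewrite setU1K ?setD11 // notin_id ?setD11 // eqxx !mul1r.
have -> : e |: A :\ e = e |: A.
  by apply/finset.setP => y; rewrite !inE; case: eqVneq.
rewrite [X in _ + X]big1 ?addr0 //.
move=> B /andP []; rewrite powersetE subsetD1 => /andP [_ eB] /negPf BA.
by rewrite setU1K // notin_id // BA !mul0r addr0.
Qed.

Lemma hb_flow_sum e A : e \in E -> A \subset E ->
  \sum_(B in Omega) hb_flow e A B = w A.
Proof.
move=> eE sAE; under eq_bigr do rewrite /hb_flow mulrC.
rewrite sum_update // -mulrDl -mulrDr addrC mulfK // gt_eqF //.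
by rewrite addr_gt0 ?rc_weight_gt0.
Qed.

Lemma hb_move_sum A : (0 < #|E|)%N -> A \subset E ->
  \sum_(B in Omega) hb_move E p q A B = 2^-1.
Proof.
move=> m_gt0 sAE; apply: (mulfI (lt0r_neq0 (rc_weight_gt0 A))).
rewrite mulr_sumr; under eq_bigr do rewrite hb_moveE.
rewrite -mulr_sumr exchange_big /=.
rewrite (eq_bigr (fun=> w A)); last by move=> e eE; rewrite hb_flow_sum.
rewrite sumr_const -mulr_natr; field.
by rewrite pnatr_eq0 -lt0n.
Qed.

Lemma hb_reversible : reversible Omega w (P_HB E p q).
Proof.
move=> A B _ _; rewrite /P_HB (eq_sym B); case: eqVneq => [->//|_].
by rewrite !hb_moveE; congr (_ * _); apply: eq_bigr => e _; apply: hb_flow_sym.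
Qed.

Lemma hb_stochastic : stochastic Omega (P_HB E p q).
Proof.
move=> A AE; rewrite (bigD1 A) //= {1}/P_HB eqxx.
rewrite [X in _ + X](eq_bigr (hb_move E p q A)) ?subrK //.
by move=> B /andP [_ BA]; rewrite /P_HB eq_sym (negPf BA).
Qed.

Lemma hb_off_diag_ge0 A B : A != B -> 0 <= P_HB E p q A B.
Proof. by move=> /negPf AB; rewrite /P_HB AB hb_move_ge0. Qed.

Lemma hb_lazy A : (0 < #|E|)%N -> A \in Omega -> 2^-1 <= P_HB E p q A A.
Proof.
move=> m_gt0 AE; rewrite /P_HB eqxx.
have := hb_move_sum m_gt0 (etrans (esym (powersetE _ _)) AE).
rewrite (bigD1 A) //=; have := hb_move_ge0 A A; lra.
Qed.

(** The moves along e from A and from e |: A have the same flow and the same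
    squared increment, which accounts for the factor 2 that cancels 1/2. *)
Lemma dirichlet_hb f : dirichlet Omega w (P_HB E p q) f =
  (2 * #|E|%:R)^-1 * \sum_(e in E) \sum_(A in powerset (E :\ e))
    w A * w (e |: A) / (w A + w (e |: A)) * (f (e |: A) - f A) ^+ 2.
Proof.
rewrite /dirichlet.
transitivity (2^-1 * \sum_(A in Omega) \sum_(B in Omega)
    (2 * #|E|%:R)^-1 * \sum_(e in E) (hb_flow e A B * (f A - f B) ^+ 2)).
  congr (_ * _); apply: eq_bigr => A _; apply: eq_bigr => B _.
  rewrite -mulr_suml [RHS]mulrA -hb_moveE /P_HB; case: eqVneq => // ->.
  by rewrite subrr expr0n !mulr0.
under eq_bigr do rewrite -mulr_sumr exchange_big /=.
rewrite -mulr_sumr exchange_big /= mulrCA; congr (_ * _).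
rewrite mulr_sumr; apply: eq_bigr => e eE.
have updateE A : A \in Omega ->
    \sum_(B in Omega) hb_flow e A B * (f A - f B) ^+ 2 =
    w A / (w (e |: A) + w (A :\ e)) * (w (A :\ e) * (f A - f (A :\ e)) ^+ 2 +
      w (e |: A) * (f A - f (e |: A)) ^+ 2).
  rewrite powersetE => sAE.
  rewrite -(sum_update (fun B => w B * (f A - f B) ^+ 2) eE sAE) mulr_sumr.
  by apply: eq_bigr => B _; rewrite /hb_flow; ring.
rewrite (eq_bigr _ updateE) (sum_split_edge _ eE) mulr_sumr.
apply: eq_bigr => A; rewrite powersetE subsetD1 => /andP [sAE eA].
have -> : A :\ e = A.
  apply/finset.setP => y; rewrite !inE.
  by case: eqVneq => //= ->; rewrite (negPf eA).
rewrite setU1K // finset.setUA finset.setUid subrr expr0n /= !subrr expr0n /=.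
by field; rewrite gt_eqF // addr_gt0 ?rc_weight_gt0.
Qed.

(** The coefficients compare because fewer colourings are compatible with
    e |: A than with A. *)
Lemma dirichlet_sw_le_hb f : (0 < #|E|)%N ->
  dirichlet Omega w (P_SW E p q) f <=
    2 * #|E|%:R * dirichlet Omega w (P_HB E p q) f.
Proof.
move=> m_gt0; rewrite dirichlet_hb mulVKf; last first.
  by rewrite mulf_neq0 ?pnatr_eq0 // -lt0n.
apply: le_trans (dirichlet_sw_le f) _.
apply: ler_sum => e eE; apply: ler_sum => A.
rewrite powersetE subsetD1 => /andP [sAE eA].
apply: ler_wpM2r; first exact: sqr_ge0.
have wA := rc_weight_gt0 A; have wU := rc_weight_gt0 (e |: A).
rewrite ler_pdivlMr ?addr_gt0 // mulrAC ler_pM2r //.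
suff : (1 - p) * w (e |: A) <= p * w A by lra.
rewrite !rc_weight_colourings //; last first.
  by rewrite finset.subUset finset.sub1set eE.
have p1_gt0 : 0 < 1 - p by rewrite subr_gt0.
have p1_neq0 : 1 - p != 0 by rewrite gt_eqF.
rewrite cardsU1 eA add1n exprS.
have oddsE : (1 - p) * odds = p by field.
have := odds_gt0; move: odds oddsE => r rE r_gt0.
rewrite !mulrA rE ler_wpM2l //; first by rewrite mulr_ge0 ?exprn_ge0 ?ltW.
apply: ler_sum => sigma _; rewrite ler_nat finset.subUset.
by case: (A \subset _); rewrite ?andbT ?andbF // leq_b1.
Qed.

Lemma spectral_gap_hb_ge0 : (0 < #|E|)%N ->
  0 <= spectral_gap Omega (P_HB E p q).
Proof.
move=> m_gt0; apply: (@spectral_gap_ge _ _ _ w).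
- by move=> A _; apply: rc_weight_gt0.
- exact: hb_reversible.
- exact: hb_stochastic.
- by move=> A B _ _; apply: hb_off_diag_ge0.
- by move=> A AE; apply: hb_lazy.
- exact: ler01.
move=> f _; rewrite mul0r dirichlet_hb.
apply: mulr_ge0; first by rewrite invr_ge0 mulr_ge0 ?ler0n.
apply: sumr_ge0 => e _; apply: sumr_ge0 => A _.
by apply: mulr_ge0; [exact: weight_ratio_ge0 | exact: sqr_ge0].
Qed.

Lemma spectral_gap_sw_le : (0 < #|E|)%N ->
  spectral_gap Omega (P_SW E p q) <=
    2 * #|E|%:R * spectral_gap Omega (P_HB E p q).
Proof.
move=> m_gt0; have m2_gt0 : 0 < 2 * #|E|%:R :> R by rewrite mulr_gt0 ?ltr0n.
have w_gt0 A : A \in Omega -> 0 < w A by move=> _; apply: rc_weight_gt0.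
rewrite mulrC -ler_pdivrMr //.
apply: (spectral_gap_ge w_gt0 hb_reversible hb_stochastic).
- by move=> A B _ _; apply: hb_off_diag_ge0.
- by move=> A AE; apply: hb_lazy.
- rewrite ler_pdivrMr // mul1r.
  apply: le_trans (spectral_gap_le1 w_gt0 sw_reversible) _.
  by rewrite -natrM ler1n muln_gt0.
move=> f mean0; rewrite mulrAC ler_pdivrMr // mulrC [leRHS]mulrC.
apply: le_trans _ (dirichlet_sw_le_hb f m_gt0).
rewrite mulrC.
exact: (spectral_gap_poincare w_gt0 sw_reversible sw_stochastic sw_gt0).
Qed.

End RandomClusterDynamics.

(** * Comparison of the spectral gaps *)

Unset Implicit Arguments.

Theorem theorem1 (R : realType) (V : finType) (E : {set {set V}})
    (p : R) (q : nat)
    (simpleE : forall e : {set V}, e \in E -> #|e| = 2%N)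
    (m_ge2 : (2 <= #|E|)%N)
    (p_gt0 : 0 < p) (p_lt1 : p < 1) (q_ge1 : (1 <= q)%N) :
  spectral_gap (powerset E) (P_SW E p q) <=
    16 * #|E|%:R * ln (#|E|%:R) * spectral_gap (powerset E) (P_HB E p q).
Proof.
have m_gt0 : (0 < #|E|)%N by rewrite (leq_trans _ m_ge2).
apply: le_trans (spectral_gap_sw_le simpleE p_gt0 p_lt1 q_ge1 m_gt0) _.
(* log (1 - 1/2) <= - 1/2 *)
have ln2_ge : 2^-1 <= ln 2 :> R.
  have := @le_ln1Dx R (- 2^-1); rewrite (_ : 1 + - 2^-1 = 2^-1); last by field.
  by rewrite lnV ?posrE // => /(_ ltac:(lra)); lra.
have ln_m : ln 2 <= ln #|E|%:R :> R by rewrite ler_ln ?posrE ?ltr0n ?ler_nat.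
apply: ler_wpM2r; first exact: spectral_gap_hb_ge0.
have m_ge0 : 0 <= #|E|%:R :> R by rewrite ler0n.
by rewrite mulrAC ler_wpM2r //; lra.
Qed.
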